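(* Let $X\in\mathbb{R}^{n\times p}$, $\beta^*\in\mathbb{R}^p$, $\varepsilon\in\mathbb{R}^n$ Gaussian with law $\mathcal{N}(0,\sigma^2I_n)$, and $y=X\beta^*+\varepsilon$. Let $\lambda_1,\lambda_2>0$. For any Lasso solution $\hat\beta^{\lambda_1}$ with parameter $\lambda_1$ and any Boosted Lasso refitting $\hat\beta^{\lambda_1,\lambda_2}$ of it, on the event $\{\|X^\top\varepsilon/n\|_\infty\le\lambda_1/2\}$ we have $$\frac1n\|X(\beta^*-\hat\beta^{\lambda_1,\lambda_2})\|_2^2+(2\lambda_2-\lambda_1)\|\hat\beta^{\lambda_1,\lambda_2}-\hat\beta^{\lambda_1}\|_1\le\frac1n\|X(\beta^*-\hat\beta^{\lambda_1})\|_2^2 .$$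
   Context: A Lasso solution with parameter $\lambda_1>0$ is any $\hat\beta^{\lambda_1}\in\arg\min_{\beta\in\mathbb{R}^p}\frac{1}{2n}\|y-X\beta\|_2^2+\lambda_1\|\beta\|_1$. A Boosted Lasso refitting is any $\hat\beta^{\lambda_1,\lambda_2}\in\arg\min_{\beta\in\mathbb{R}^p}\frac1{2n}\|y-X\beta\|_2^2+\lambda_2\|\beta-\hat\beta^{\lambda_1}\|_1$. *)

(* Defs.v *)
From HB Require Import structures.
From mathcomp Require Import all_boot all_order all_algebra.
From mathcomp Require Import all_classical all_reals all_analysis.

Set Implicit Arguments.
Unset Strict Implicit.
Unset Printing Implicit Defensive.

Import Order.TTheory GRing.Theory Num.Theory.
Import numFieldNormedType.Exports.

Local Open Scope classical_set_scope.
Local Open Scope ring_scope.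

(* On matrices, hence on column vectors, the library norm `|v| is the sup norm
   (mx_norm), so only the l1 and l2 norms have to be introduced. *)
Definition l1norm (R : realType) (k : nat) (v : 'cV[R]_k) : R :=
  \sum_(i < k) `|v i 0|.

Definition l2norm (R : realType) (k : nat) (v : 'cV[R]_k) : R :=
  Num.sqrt (\sum_(i < k) v i 0 ^+ 2).

Definition argmin (R : realType) (E : Type) (f : E -> R) : set E :=
  [set x | forall z, f x <= f z].

Definition lasso (R : realType) (n p : nat) (X : 'M[R]_(n, p)) (y : 'cV[R]_n)
    (lambda1 : R) : set 'cV[R]_p :=
  argmin (fun b : 'cV[R]_p =>
    (2 * n%:R)^-1 * l2norm (y - X *m b) ^+ 2 + lambda1 * l1norm b).

Definition boosted_lasso (R : realType) (n p : nat) (X : 'M[R]_(n, p))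
    (y : 'cV[R]_n) (b1 : 'cV[R]_p) (lambda2 : R) : set 'cV[R]_p :=
  argmin (fun b : 'cV[R]_p =>
    (2 * n%:R)^-1 * l2norm (y - X *m b) ^+ 2 + lambda2 * l1norm (b - b1)).

(* The law N(m, s^2) on R. The library's normal_prob m s is parametrized by the
   standard deviation and, for s = 0, is the uniform law on [0, 1]; the
   degenerate Gaussian is the Dirac mass at m. *)
Definition gaussian_law (R : realType) (m s : R) (A : set R) : \bar R :=
  if s == 0 then \d_m A else normal_prob m s A.

(* eps is a random vector of law N(0, sigma^2 I_n), i.e. the n-fold product of
   N(0, sigma^2). A law on R^n is determined by its values on measurable boxes,
   and eps is measurable iff all its coordinates are. *)
Definition isotropic_gaussian (R : realType) (d : measure_display)
    (T : measurableType d) (P : probability T R) (n : nat) (sigma : R)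
    (eps : T -> 'cV[R]_n) : Prop :=
  (forall i : 'I_n, measurable_fun [set: T] (fun w => eps w i 0)) /\
  (forall A : 'I_n -> set R, (forall i, measurable (A i)) ->
    P [set w | forall i, A i (eps w i 0)] =
    (\prod_(i < n) gaussian_law 0 sigma (A i))%E).

(* Main.v *)
(** Comparing the refitted objective at [b2] and at [b1], where the penalty
    vanishes, and expanding both squares around [X bstar], leaves only the
    cross term [<X^T eps / n, b2 - b1>], which l1/sup-norm duality bounds by
    [lambda1 / 2 * |b2 - b1|_1]. *)
Require Import Defs.
From HB Require Import structures.
From mathcomp Require Import all_boot all_order all_algebra.
From mathcomp Require Import all_classical all_reals all_analysis.
From mathcomp Require Import ring lra.

Set Implicit Arguments.
Unset Strict Implicit.
Unset Printing Implicit Defensive.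

Import Order.TTheory GRing.Theory Num.Theory.
Import numFieldNormedType.Exports.

Local Open Scope classical_set_scope.
Local Open Scope ring_scope.

Lemma sqr_l2norm (R : realType) (k : nat) (v : 'cV[R]_k) :
  l2norm v ^+ 2 = \sum_(i < k) v i 0 ^+ 2.
Proof. by rewrite /l2norm sqr_sqrtr // sumr_ge0 // => i _; exact: sqr_ge0. Qed.

(** The cross term is kept as a matrix product, so that a matrix factor of [u] can later be moved
    onto [v] by associativity. *)
Lemma sqr_l2normD (R : realType) (k : nat) (u v : 'cV[R]_k) :
  l2norm (u + v) ^+ 2 = l2norm u ^+ 2 + 2 * (v^T *m u) 0 0 + l2norm v ^+ 2.
Proof.
rewrite !sqr_l2norm mxE mulr_sumr -!big_split; apply: eq_bigr => i _ /=.
by rewrite !mxE; ring.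
Qed.

Lemma l1norm0 (R : realType) (k : nat) : l1norm (0 : 'cV[R]_k) = 0.
Proof. by apply: big1 => i _; rewrite mxE normr0. Qed.

Lemma normr_coord_le (R : realType) (k : nat) (v : 'cV[R]_k) (i : 'I_k) :
  `|v i 0| <= `|v|.
Proof. by rewrite /Num.norm /= mx_normrE; apply: (le_bigmax _ _ (i, 0)). Qed.

(** Hölder, term by term: in absolute value each [u i 0] is at most the sup norm. *)
Lemma dot_le_norm_l1norm (R : realType) (k : nat) (u v : 'cV[R]_k) :
  (u^T *m v) 0 0 <= `|u| * l1norm v.
Proof.
rewrite mxE mulr_sumr; apply: ler_sum => i _; rewrite mxE.
apply: le_trans (ler_norm _) _; rewrite normrM.
by rewrite ler_wpM2r // normr_coord_le.
Qed.

Theorem lemma3 (R : realType) (n p : nat)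
    (X : 'M[R]_(n, p)) (bstar : 'cV[R]_p)
    (d : measure_display) (T : measurableType d) (P : probability T R)
    (sigma : R) (eps : T -> 'cV[R]_n)
    (heps : isotropic_gaussian P sigma eps)
    (y : T -> 'cV[R]_n) (hy : forall w, y w = X *m bstar + eps w)
    (lambda1 lambda2 : R) (hlambda1 : 0 < lambda1) (hlambda2 : 0 < lambda2) :
  forall w : T,
    w \in [set w | `| n%:R^-1 *: (X^T *m eps w) | <= lambda1 / 2] ->
  forall b1 : 'cV[R]_p, b1 \in lasso X (y w) lambda1 ->
  forall b2 : 'cV[R]_p, b2 \in boosted_lasso X (y w) b1 lambda2 ->
    n%:R^-1 * l2norm (X *m (bstar - b2)) ^+ 2
      + (2 * lambda2 - lambda1) * l1norm (b2 - b1)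
    <= n%:R^-1 * l2norm (X *m (bstar - b1)) ^+ 2.
Proof.
move=> w; rewrite inE /= => hX b1 _ b2; rewrite inE => /(_ b1) /=.
have res b : y w - X *m b = X *m (bstar - b) + eps w.
  by rewrite hy mulmxBr addrAC.
(* [invfM] isolates the factor [n%:R^-1]; since [0^-1 = 0], this covers [n = 0] too. *)
rewrite !res !sqr_l2normD subrr l1norm0 invfM.
have cross : n%:R^-1 * ((eps w)^T *m (X *m (bstar - b1))) 0 0
    - n%:R^-1 * ((eps w)^T *m (X *m (bstar - b2))) 0 0
    <= lambda1 / 2 * l1norm (b2 - b1).
  (* Adjointness moves [X] onto the noise, and [bstar] cancels in the difference. *)
  have -> : n%:R^-1 * ((eps w)^T *m (X *m (bstar - b1))) 0 0
      - n%:R^-1 * ((eps w)^T *m (X *m (bstar - b2))) 0 0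
      = ((n%:R^-1 *: (X^T *m eps w))^T *m (b2 - b1)) 0 0.
    have -> : b2 - b1 = (bstar - b1) - (bstar - b2).
      by rewrite opprB [RHS]addrC subrKA.
    rewrite [(_ *: _)^T]linearZ /= trmx_mul trmxK -scalemxAl -mulmxA !mulmxBr.
    by rewrite !mxE; ring.
  apply: le_trans (dot_le_norm_l1norm _ _) _.
  by rewrite ler_wpM2r // sumr_ge0.
(* Twice the optimality inequality plus twice [cross]: the [l2norm (eps w) ^+ 2] terms cancel, and
   products with the opaque scalar [c] act as atoms. *)
by move: n%:R^-1 cross => c; lra.
Qed.
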